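(* Let $n = m\lambda$ with $m,\lambda$ positive integers. If there exists a set of $E\geq 1$ mutually orthogonal frequency squares of type $F(n;\lambda)$, then \[ M_\lambda(n\lambda, n\lambda-\lambda^2) \geq mE. \] In particular, if $q$ is a prime power and $i \geq 1$ is a positive integer, then \[ M_{q^{i-1}}(q^{2i-1}, q^{2i-1}-q^{2i-2}) \geq \frac{q(q^i-1)^2}{q-1}. \] Further, if $i=1$, then $M_1(q,q-1) = q(q-1)$.
   Context: A $\lambda$-permutation of length $N$ (where $\lambda$ divides $N$) is an arrangement (sequence of length $N$) of the multiset consisting of $N/\lambda$ distinct symbols, each repeated exactly $\lambda$ times. The distance between two $\lambda$-permutations is the Hamming distance, i.e. the number of positions in which they disagree. A frequency permutation array $FPA_\lambda(N,d)$ is a set $T$ of $\lambda$-permutations of length $N$ (on a common set of $N/\lambda$ symbols) such that any two distinct members of $T$ have distance at least $d$; its size is $|T|$. $M_\lambda(N,d)$ denotes the maximum size of an $FPA_\lambda(N,d)$. Let $n=m\lambda$. An $F(n;\lambda)$ frequency square is an $n\times n$ array in which each of $m$ distinct symbols (from a fixed $m$-element symbol set) occurs exactly $\lambda$ times in each row and each column. Two such squares are orthogonal if, when superimposed, each of the $m^2$ possible ordered pairs of symbols occurs exactly $\lambda^2$ times. A set of such squares is mutually orthogonal if its distinct members are pairwise orthogonal. *)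

(* Defs.v *)
From mathcomp Require Import all_boot all_order all_algebra.
Set Implicit Arguments.
Unset Strict Implicit.
Unset Printing Implicit Defensive.

Definition hamming (N : nat) (A : eqType) (s t : N.-tuple A) : nat :=
  #|[set k : 'I_N | tnth s k != tnth t k]|.

(* The N / lam symbols are taken to be the elements of 'I_(N %/ lam); the
   notion is only meant for lam > 0 dividing N. *)
Definition is_lam_perm (lam N : nat) (t : N.-tuple 'I_(N %/ lam)) : bool :=
  [forall a : 'I_(N %/ lam), count_mem a t == lam].

Definition is_FPA (lam N d : nat) (T : {set N.-tuple 'I_(N %/ lam)}) : bool :=
  [forall s in T, is_lam_perm s] &&
  [forall s in T, forall t in T, (s != t) ==> (d <= hamming s t)].

Definition maxFPA (lam N d : nat) : nat :=
  \max_(T : {set N.-tuple 'I_(N %/ lam)} | is_FPA d T) #|T|.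

Definition is_freq_square (lam n m : nat) (F : 'M['I_m]_n) : bool :=
  [forall r : 'I_n, forall a : 'I_m, #|[set c : 'I_n | F r c == a]| == lam] &&
  [forall c : 'I_n, forall a : 'I_m, #|[set r : 'I_n | F r c == a]| == lam].

Definition orthogonal_squares (lam n m : nat) (F G : 'M['I_m]_n) : bool :=
  [forall a : 'I_m, forall b : 'I_m,
    #|[set x : 'I_n * 'I_n | (F x.1 x.2 == a) && (G x.1 x.2 == b)]|
      == lam ^ 2].

Definition is_MOFS (lam n m : nat) (S : {set 'M['I_m]_n}) : bool :=
  [forall F in S, is_freq_square lam F] &&
  [forall F in S, forall G in S, (F != G) ==> orthogonal_squares lam F G].

Definition prime_power (q : nat) : Prop :=
  exists p k : nat, [/\ prime p, 0 < k & q = p ^ k].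

(* Main.v *)
(* For a frequency square F and a symbol a, list row after row the columns in
   which a occurs: each column appears lam times, so this is a lam-permutation.
   Words of distinct symbols of one square never agree, and words of orthogonal
   squares agree in at most lam ^ 2 positions.  Over a field with q elements the
   squares u x + v y, for nonzero u and v taken up to a common scalar, are
   mutually orthogonal, because two non-proportional linear forms in (x, y) are
   jointly equidistributed; there are (q ^ i - 1) ^ 2 / (q - 1) of them. *)

Require Import Defs.
From mathcomp Require Import all_boot all_order all_algebra.
From mathcomp Require Import finfield.

Import GRing.Theory.

(** * Words read off a frequency square *)

Lemma exists_ord_bij (T : finType) (n : nat) :
  #|T| = n -> exists f : 'I_n -> T, bijective f.
Proof. by move=> <-; exists enum_val; apply: enum_val_bij. Qed.

Lemma hamming_agree (N : nat) (A : eqType) (s t : N.-tuple A) :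
  hamming s t = N - #|[set k : 'I_N | tnth s k == tnth t k]|.
Proof.
rewrite /hamming -[X in X - _](card_ord N).
rewrite -(cardsC [set k : 'I_N | tnth s k == tnth t k]) addKn.
by congr #|pred_of_set _|; apply/setP=> k; rewrite !inE.
Qed.

Lemma count_mem_tnth (N : nat) (A : eqType) (a : A) (t : N.-tuple A) :
  count_mem a t = #|[set k : 'I_N | tnth t k == a]|.
Proof.
rewrite cardsE cardE size_filter -enumT -[in LHS](map_tnth_enum t) count_map.
by apply: eq_count.
Qed.

(** [pos] splits a position into a row and a rank among the [lam] occurrences of [a] in that row;
    [sym] renames columns as symbols of the array. The default of [nth] is never reached when [F] is
    a frequency square. *)
Definition symbol_word (n m lam N : nat) (A : eqType)
    (pos : 'I_N -> 'I_n * 'I_lam) (sym : 'I_n -> A)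
    (F : 'M['I_m]_n) (a : 'I_m) : N.-tuple A :=
  [tuple sym (nth (pos k).1 (enum [set c | F (pos k).1 c == a]) (pos k).2)
     | k < N].

Section SymbolWord.

Context {n m lam N : nat} {A : eqType}.
Context {pos : 'I_N -> 'I_n * 'I_lam} {sym : 'I_n -> A}.
Hypotheses (pos_bij : bijective pos) (sym_inj : injective sym).

Notation word := (symbol_word n m lam N A pos sym).

Lemma size_row_symbol (F : 'M['I_m]_n) (r : 'I_n) (a : 'I_m) :
  is_freq_square lam F -> size (enum [set c | F r c == a]) = lam.
Proof.
by case/andP=> /forallP/(_ r)/forallP/(_ a)/eqP + _; rewrite -cardE.
Qed.

Lemma symbol_wordP (F : 'M['I_m]_n) (a : 'I_m) (k : 'I_N) :
  is_freq_square lam F ->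
  exists2 c, tnth (word F a) k = sym c & F (pos k).1 c = a.
Proof.
move=> hF; set s := enum [set c | F (pos k).1 c == a].
exists (nth (pos k).1 s (pos k).2); first by rewrite tnth_mktuple.
have: nth (pos k).1 s (pos k).2 \in s by rewrite mem_nth // size_row_symbol.
by rewrite mem_enum inE => /eqP.
Qed.

Lemma symbol_word_row_inj (F : 'M['I_m]_n) (a : 'I_m) (k l : 'I_N) :
  is_freq_square lam F -> (pos k).1 = (pos l).1 ->
  tnth (word F a) k = tnth (word F a) l -> k = l.
Proof.
move=> hF ekl; rewrite !tnth_mktuple -ekl => /sym_inj /eqP.
rewrite nth_uniq ?enum_uniq ?size_row_symbol // => /eqP/val_inj ekl2.
by apply: (bij_inj pos_bij); case: (pos k) (pos l) ekl ekl2 => ? ? [? ?] /= -> ->.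
Qed.

(** Taking rows maps the positions holding [sym c] bijectively onto the rows where column [c]
    contains [a], and the column condition counts these. *)
Lemma count_symbol_word (F : 'M['I_m]_n) (a : 'I_m) (c : 'I_n) :
  is_freq_square lam F -> count_mem (sym c) (word F a) = lam.
Proof.
move=> hF; rewrite count_mem_tnth; transitivity #|[set r | F r c == a]|; last first.
  by case/andP: hF => _ /forallP/(_ c)/forallP/(_ a)/eqP.
rewrite -(card_in_imset (f := fun k => (pos k).1)) => [|k l]; last first.
  rewrite !inE => /eqP hk /eqP hl /symbol_word_row_inj-/(_ F a hF); apply.
  by rewrite hk.
congr #|pred_of_set _|; apply/setP=> r; rewrite inE; apply/imsetP/idP.
  case=> k; rewrite inE => /eqP hk ->.
  by case: (symbol_wordP F a k hF) => c'; rewrite hk => /sym_inj <- ->.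
move=> hr; have cin : c \in enum [set c | F r c == a] by rewrite mem_enum inE.
have hj : index c (enum [set c | F r c == a]) < lam.
  by rewrite -(size_row_symbol F r a hF) index_mem.
case: (pos_bij) => inv _ invK; exists (inv (r, Ordinal hj)); last by rewrite invK.
by rewrite inE tnth_mktuple invK /= nth_index.
Qed.

(* A common entry in the same position is a common cell of the two symbols. *)
Lemma agree_symbol_word (F G : 'M['I_m]_n) (a b : 'I_m) :
  is_freq_square lam F -> is_freq_square lam G ->
  #|[set k | tnth (word F a) k == tnth (word G b) k]|
    <= #|[set x : 'I_n * 'I_n | (F x.1 x.2 == a) && (G x.1 x.2 == b)]|.
Proof.
move=> hF hG.
pose col k := nth (pos k).1 (enum [set c | F (pos k).1 c == a]) (pos k).2.
have colE k : tnth (word F a) k = sym (col k) by rewrite tnth_mktuple.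
rewrite -(card_in_imset (f := fun k => ((pos k).1, col k))) => [|k l _ _]; last first.
  by case=> e1 e2; apply: (symbol_word_row_inj F a) => //; rewrite !colE e2.
apply/subset_leq_card/subsetP=> x /imsetP[k]; rewrite inE => /eqP e ->.
rewrite inE /=; case: (symbol_wordP F a k hF) => c; rewrite colE => /sym_inj <- ->.
case: (symbol_wordP G b k hG) => c'; rewrite -e colE => /sym_inj <- ->.
by rewrite !eqxx.
Qed.

End SymbolWord.

(** * From orthogonal squares to a frequency permutation array *)

Lemma card_le_maxFPA (lam N d : nat) (T : {set N.-tuple 'I_(N %/ lam)}) :
  is_FPA d T -> #|T| <= maxFPA lam N d.
Proof. by move=> hT; apply: (leq_bigmax_cond _ hT). Qed.

Lemma MOFS_maxFPA (n m lam : nat) (S : {set 'M['I_m]_n}) :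
  0 < m -> 0 < lam -> n = m * lam -> is_MOFS lam S ->
  m * #|S| <= maxFPA lam (n * lam) (n * lam - lam ^ 2).
Proof.
move=> m0 l0 nE /andP[/forall_inP hS /forall_inP hO].
have n0 : 0 < n by rewrite nE muln_gt0 m0.
have [pos pos_bij] : exists f : 'I_(n * lam) -> 'I_n * 'I_lam, bijective f.
  by apply: exists_ord_bij; rewrite card_prod !card_ord.
have [sym sym_bij] : exists f : 'I_n -> 'I_(n * lam %/ lam), bijective f.
  by apply: exists_ord_bij; rewrite card_ord mulnK.
have sym_inj := bij_inj sym_bij.
pose word (p : 'M['I_m]_n * 'I_m) :=
  symbol_word n m lam (n * lam) _ pos sym p.1 p.2.
pose agree p1 p2 := #|[set k | tnth (word p1) k == tnth (word p2) k]|.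
have agree_le p1 p2 : p1.1 \in S -> p2.1 \in S -> p1 != p2 ->
    (p1.1 == p2.1) && (agree p1 p2 == 0) ||
    (p1.1 != p2.1) && (agree p1 p2 <= lam ^ 2).
  case: p1 p2 => [F a] [G b] /= hF hG.
  have := agree_symbol_word pos_bij sym_inj F G a b (hS _ hF) (hS _ hG).
  rewrite -/(agree (F, a) (G, b)); case: (eqVneq F G) => [<-|FG] /= le_ab ab.
    rewrite orbF -leqn0 (leq_trans le_ab) // leqn0 cards_eq0; apply/eqP/setP=> x.
    by rewrite !inE; apply/andP=> -[/eqP ea /eqP eb]; rewrite -ea -eb eqxx in ab.
  have /forall_inP/(_ G hG)/implyP/(_ FG) := hO F hF.
  by move=> /forallP/(_ a)/forallP/(_ b)/eqP <-.
have agree_self p : agree p p = n * lam.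
  transitivity #|'I_(n * lam)|; last exact: card_ord.
  by apply: eq_card => k; rewrite !inE eqxx.
have word_inj : {in setX S setT &, injective word}.
  move=> p1 p2; rewrite !inE !andbT => h1 h2 e.
  apply/eqP/negPn/negP=> p12; have := agree_le _ _ h1 h2 p12.
  have -> : agree p1 p2 = n * lam by rewrite /agree -e; apply: agree_self.
  (* Equal words agree in all [n * lam] positions. This is nonzero, so the squares differ and
     [n * lam <= lam ^ 2], whence [m <= 1]; but over a single symbol there is only one square. *)
  rewrite muln_eq0 !gtn_eqF //= andbF /= expnS expn1 leq_pmul2r //.
  have -> : (n <= lam) = (m <= 1) by rewrite nE -[X in _ <= X]mul1n leq_pmul2r.
  case/andP=> /eqP FG m1; apply: FG; apply/matrixP=> r c; apply: val_inj.
  by move: (p1.1 r c) (p2.1 r c) => [[|?] h] [[|?] h'] //=;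
     [move: (leq_trans h' m1) | move: (leq_trans h m1) | move: (leq_trans h m1)].
have cardT : #|word @: setX S setT| = m * #|S|.
  by rewrite card_in_imset // cardsX cardsT card_ord mulnC.
rewrite -cardT; apply: card_le_maxFPA; apply/andP; split.
  apply/forall_inP=> _ /imsetP[[F a] /setXP[/hS hF _] ->]; apply/forallP=> x.
  case: (sym_bij) => inv _ /(_ x) <-; apply/eqP.
  exact: count_symbol_word.
apply/forall_inP=> _ /imsetP[p1 /[!inE]/andP[h1 _] ->].
apply/forall_inP=> _ /imsetP[p2 /[!inE]/andP[h2 _] ->]; apply/implyP=> ne.
rewrite hamming_agree leq_sub2l //.
have /agree_le-/(_ h1 h2) : p1 != p2 by apply: contraNneq ne => ->.
by case/orP=> /andP[_] // /eqP; rewrite /agree => ->.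
Qed.

(** * Linear squares over a finite field *)

Section LinearSquares.

Local Open Scope ring_scope.

Context {K : finFieldType}.

(** Free rows give [A] the right inverse [pinvmx A], so every fibre of [mulmx A] is a translate of
    the kernel; these equal fibres, one for each of the #|K| ^ r values, partition the space. *)
Lemma card_affine_solutions (r s : nat) (A : 'M[K]_(r, s)) (b : 'cV_r) :
  row_free A -> #|[set z : 'cV_s | A *m z == b]| = (#|K| ^ (s - r))%N.
Proof.
move=> freeA; have le_rs : (r <= s)%N by rewrite -(eqP freeA) rank_leq_col.
pose sol b := [set z : 'cV_s | A *m z == b].
have card_sol c : #|sol c| = #|sol 0|.
  rewrite -(card_imset (sol 0) (addIr (pinvmx A *m c))).
  apply: eq_card => z; rewrite inE; apply/eqP/imsetP => [hz | [y]].
    exists (z - pinvmx A *m c); rewrite ?subrK // inE.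
    by rewrite mulmxBr hz mulmxA mulmxVp // mul1mx subrr.
  by rewrite inE => /eqP hy ->; rewrite mulmxDr hy mulmxA mulmxVp // mul1mx add0r.
have : (#|K| ^ s = #|K| ^ r * #|sol b|)%N.
  have -> : (#|K| ^ s = #|[set: 'cV[K]_s]|)%N by rewrite cardsT card_mx muln1.
  have -> : (#|K| ^ r = #|'cV[K]_r|)%N by rewrite card_mx muln1.
  rewrite -sum1_card (partition_big (mulmx A) predT) //=.
  rewrite -sum_nat_const; apply: eq_bigr => c _.
  by rewrite card_sol -(card_sol c) -sum1_card; apply: eq_bigl => z; rewrite !inE.
rewrite -{1}(subnKC le_rs) expnD => /eqP.
rewrite eqn_pmul2l ?expn_gt0 ?(ltnW (finNzRing_gt1 _)) //.
by move/eqP=> ->.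
Qed.

Lemma row_free_rV (s : nat) (u : 'rV[K]_s) : u != 0 -> row_free u.
Proof. by rewrite /row_free rank_rV => ->. Qed.

(** Homogeneous of degree one and zero only at the zero vector, so the value 1 singles out one
    vector on each line through the origin. *)
Definition first_coord (s : nat) (u : 'rV[K]_s) : K :=
  if [pick k | u 0 k != 0] is Some k then u 0 k else 0.

Lemma first_coordZ (s : nat) (a : K) (u : 'rV_s) :
  first_coord s (a *: u) = a * first_coord s u.
Proof.
rewrite /first_coord; case: (eqVneq a 0) => [-> | a0].
  by case: pickP => [k|_]; rewrite ?mxE !mul0r // eqxx.
have /eq_pick -> : (fun k => (a *: u) 0 k != 0) =1 (fun k => u 0 k != 0).
  by move=> k; rewrite mxE mulf_eq0 negb_or a0.
by case: pickP => [k _|_]; rewrite ?mxE ?mulr0.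
Qed.

Lemma first_coord_eq0 (s : nat) (u : 'rV_s) : (first_coord s u == 0) = (u == 0).
Proof.
rewrite /first_coord; case: pickP => [k uk | u0].
  by rewrite (negbTE uk); apply/esym/negbTE; apply: contraNneq uk => ->; rewrite mxE.
by rewrite eqxx; apply/esym/eqP/rowP=> k; rewrite mxE; apply/eqP/negbFE/u0.
Qed.

Lemma card_rV_neq0 (s : nat) : #|[set~ 0 : 'rV[K]_s]| = (#|K| ^ s - 1)%N.
Proof. by rewrite cardsC1 card_mx mul1n subn1. Qed.

(** Every nonzero vector is uniquely a nonzero scalar times a normalized vector. *)
Lemma card_normalized (s : nat) :
  (#|[set u : 'rV[K]_s | first_coord s u == 1%R]| * (#|K| - 1) = #|K| ^ s - 1)%N.
Proof.
set P := [set u | _]; have -> : (#|K| - 1 = #|[set~ 0%R : K]|)%N by rewrite cardsC1 subn1.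
rewrite -cardsX -card_rV_neq0.
rewrite -(card_in_imset (f := fun x : 'rV_s * K => x.2 *: x.1)) => [|x y]; last first.
  rewrite !inE => /andP[/eqP x1 x2] /andP[/eqP y1 y2] e.
  have e2 : x.2 = y.2.
    by have := congr1 (first_coord s) e; rewrite !first_coordZ x1 y1 !mulr1.
  case: x y e2 e x1 x2 y1 y2 => [x c] [y d] /= -> /(scalerI _) e _ _ _ d0.
  by rewrite e.
congr #|pred_of_set _|; apply/setP=> u; rewrite !inE; apply/imsetP/idP.
  case=> -[p c]; rewrite !inE /= => /andP[/eqP p1 c0] ->.
  by rewrite -first_coord_eq0 first_coordZ p1 mulr1.
rewrite -first_coord_eq0 => u0.
exists ((first_coord s u)^-1 *: u, first_coord s u).
  by rewrite !inE /= first_coordZ mulVf ?u0 ?eqxx.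
by rewrite /= scalerA mulfV // scale1r.
Qed.

(* Requiring the first nonzero coordinate of u to be 1 selects one pair (u, v)
   in each class of proportional pairs with u nonzero. *)
Lemma row_free_normalized (s t : nat) (u u' : 'rV[K]_s) (v v' : 'rV[K]_t) :
  first_coord s u = 1 -> first_coord s u' = 1 -> (u, v) != (u', v') ->
  row_free (col_mx (row_mx u v) (row_mx u' v')).
Proof.
move=> hu hu' ne; apply: inj_row_free => x.
rewrite -[x]hsubmxK mul_row_col [lsubmx x]mx11_scalar [rsubmx x]mx11_scalar.
set a := lsubmx x 0 0; set b := rsubmx x 0 0.
rewrite !mul_scalar_mx !scale_row_mx add_row_mx => /eqP.
rewrite -row_mx0 => /eqP/eq_row_mx[e1 e2].
(* Comparing leading coordinates in a u + b u' = 0 gives b = -a; a nonzero a would then force both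
   pairs to coincide. *)
have ba : b = - a.
  have := congr1 (first_coord s) (addr0_eq e1).
  by rewrite -scaleNr !first_coordZ hu hu' !mulr1.
suff a0 : a = 0 by rewrite ba a0 oppr0 raddf0 row_mx0.
apply/eqP; apply: contraNT ne => a0.
move: e1 e2; rewrite ba !scaleNr => /subr0_eq/(scalerI a0) -> /subr0_eq/(scalerI a0) ->.
by rewrite eqxx.
Qed.

Definition linear_square (n m s : nat) (e : 'I_n -> 'cV[K]_s)
    (g : 'M[K]_1 -> 'I_m) (w : 'rV[K]_s * 'rV[K]_s) : 'M['I_m]_n :=
  \matrix_(r, c) g (w.1 *m e r + w.2 *m e c).

Context {n m s : nat} {e : 'I_n -> 'cV[K]_s} {g : 'M[K]_1 -> 'I_m}.
Hypotheses (e_bij : bijective e) (g_bij : bijective g).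

Lemma freq_linear_square (w : 'rV[K]_s * 'rV[K]_s) :
  w.1 != 0 -> w.2 != 0 ->
  is_freq_square (#|K| ^ (s - 1)) (linear_square n m s e g w).
Proof.
case: w => u v /= u0 v0; case: (g_bij) => g' gK g'K.
have card_row (w : 'rV_s) (x : 'M_1) : w != 0 ->
    #|[set k | w *m e k == x]| = (#|K| ^ (s - 1))%N.
  move=> w0; rewrite -(card_affine_solutions 1 s w x (row_free_rV _ _ w0)).
  rewrite -(on_card_preimset (f := e)); last exact: onW_bij.
  by apply: eq_card => k; rewrite !inE.
apply/andP; split; apply/forallP=> k; apply/forallP=> a; apply/eqP.
  rewrite -(card_row v (g' a - u *m e k) v0); apply: eq_card => j; rewrite !inE mxE /=.
  by rewrite (can2_eq gK g'K) addrC eq_sym -subr_eq eq_sym.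
rewrite -(card_row u (g' a - v *m e k) u0); apply: eq_card => j; rewrite !inE mxE /=.
by rewrite (can2_eq gK g'K) eq_sym -subr_eq eq_sym.
Qed.

(** Stacking the row and column vectors turns a prescribed pair of symbols into an affine system of
    two independent equations in 2s unknowns. *)
Lemma orthogonal_linear_square (w w' : 'rV[K]_s * 'rV[K]_s) :
  first_coord s w.1 = 1 -> first_coord s w'.1 = 1 -> w != w' ->
  orthogonal_squares (#|K| ^ (s - 1))
    (linear_square n m s e g w) (linear_square n m s e g w').
Proof.
case: w w' => [u v] [u' v'] /= hu hu' ne; case: (g_bij) => g' gK g'K.
apply/forallP=> a; apply/forallP=> b; apply/eqP.
have free := row_free_normalized _ _ _ _ _ _ hu hu' ne.
rewrite -expnM mulnBl mul1n muln2 -addnn.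
rewrite -(card_affine_solutions _ _ _ (col_mx (g' a) (g' b)) free).
pose h (x : 'I_n * 'I_n) := col_mx (e x.1) (e x.2).
rewrite -(on_card_preimset (f := h)); last first.
  apply: onW_bij; case: e_bij => e' eK e'K.
  exists (fun z => (e' (usubmx z), e' (dsubmx z))) => [[x y] | z].
    by rewrite /h /= col_mxKu col_mxKd !eK.
  by rewrite /h /= !e'K vsubmxK.
apply: eq_card => x; rewrite !inE !mxE /= !(can2_eq gK g'K) /h.
rewrite mul_col_mx !mul_row_col.
apply/andP/eqP => [[/eqP -> /eqP ->] // | /eq_col_mx[-> ->]].
by rewrite !eqxx.
Qed.

End LinearSquares.

Lemma linear_MOFS (q i : nat) : prime_power q -> 0 < i ->
  exists S : {set 'M['I_q]_(q ^ i)},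
    is_MOFS (q ^ (i - 1)) S /\ #|S| * (q - 1) = (q ^ i - 1) ^ 2.
Proof.
case=> p [k [p_pr k0 qE]] i0.
have [K _ cardK] := pPrimePowerField p_pr k0.
have {p k p_pr k0 qE}cardK : #|K| = q by rewrite cardK qE.
have q1 : 1 < q by rewrite -cardK finNzRing_gt1.
have [e e_bij] : exists f : 'I_(q ^ i) -> 'cV[K]_i, bijective f.
  by apply: exists_ord_bij; rewrite card_mx muln1 cardK.
have [g' [g g'K gK]] : exists f : 'I_q -> 'M[K]_1, bijective f.
  by apply: exists_ord_bij; rewrite card_mx muln1 cardK expn1.
have g_bij : bijective g by exists g'.
pose W := setX [set u : 'rV[K]_i | first_coord i u == 1%R] [set~ 0%R : 'rV[K]_i].
pose sq := linear_square (q ^ i) q i e g.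
have ortho : {in W &, forall w w', w != w' ->
    orthogonal_squares (q ^ (i - 1)) (sq w) (sq w')}.
  move=> [u v] [u' v']; rewrite !inE /= => /andP[/eqP hu _] /andP[/eqP hu' _] ne.
  by rewrite -[X in orthogonal_squares (X ^ _)]cardK; apply: orthogonal_linear_square.
have sq_inj : {in W &, injective sq}.
  move=> w w' hw hw' eww'; apply/eqP/negPn/negP=> /(ortho _ _ hw hw').
  (* A square orthogonal to itself would need a cell holding both symbols 0 and 1. *)
  rewrite eww' => /forallP/(_ (Ordinal (ltnW q1)))/forallP/(_ (Ordinal q1)).
  rewrite eq_card0 => [|x]; last by rewrite !inE; case: eqP => // ->.
  by rewrite eq_sym -expnM expn_eq0 gtn_eqF // ltnW.
exists (sq @: W); split; last first.
  rewrite card_in_imset // cardsX card_rV_neq0 mulnAC -cardK card_normalized.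
  by rewrite expnS expn1.
apply/andP; split.
  apply/forall_inP=> _ /imsetP[[u v] /setXP[+ +] ->]; rewrite !inE => /eqP hu v0.
  rewrite -[X in is_freq_square (X ^ _)]cardK; apply: freq_linear_square => //=.
  by rewrite -first_coord_eq0 hu oner_eq0.
apply/forall_inP=> _ /imsetP[w hw ->]; apply/forall_inP=> _ /imsetP[w' hw' ->].
by apply/implyP=> ne; apply: ortho => //; apply: contraNneq ne => ->.
Qed.

(* Two members of the array agree in at most one position, so each is
   determined by its entries in the first two positions. *)
Lemma maxFPA1_le (q : nat) : 1 < q -> maxFPA 1 q (q - 1) <= q * (q - 1).
Proof.
move=> q1; apply/bigmax_leqP=> T /andP[/forall_inP hT /forall_inP hd].
pose k0 : 'I_q := Ordinal (ltnW q1); pose k1 : 'I_q := Ordinal q1.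
have inj (t : q.-tuple 'I_(q %/ 1)) : t \in T -> injective (tnth t).
  move=> /hT /forallP cnt; apply/tuple_uniqP.
  by apply: count_mem_uniq => a; rewrite (eqP (cnt a)) -has_pred1 has_count (eqP (cnt a)).
pose f (t : q.-tuple 'I_(q %/ 1)) := (tnth t k0, tnth t k1).
have f_inj : {in T &, injective f}.
  move=> s t hs ht [e0 e1]; apply/eqP/negPn/negP=> ne.
  have := hd s hs => /forall_inP/(_ t ht)/implyP/(_ ne); rewrite hamming_agree.
  apply/negP; rewrite -ltnNge ltn_sub2l //.
  apply: (@leq_trans #|[set k0; k1]|); first by rewrite cards2.
  by apply/subset_leq_card/subsetP=> k; rewrite !inE => /orP[]/eqP->; rewrite ?e0 ?e1.
rewrite -(card_in_imset f_inj).
(* Entries of a member are distinct, so its first two form an off-diagonal pair. *)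
pose D := [set (a, a) | a : 'I_(q %/ 1)].
have cardD : #|D| = q by rewrite card_imset ?card_ord ?divn1 // => a b [].
have -> : q * (q - 1) = #|~: D|.
  by rewrite cardsCs setCK cardD card_prod !card_ord divn1 mulnBr muln1.
apply/subset_leq_card/subsetP=> _ /imsetP[t ht ->]; rewrite inE.
by apply/imsetP=> -[a _ [<-]] /(inj t ht).
Qed.

(* The division by q - 1 below is exact, since q - 1 divides q ^ i - 1. *)
Theorem theorem3p2 :
  [/\ forall (n m lam E : nat),
        0 < m -> 0 < lam -> n = m * lam -> 1 <= E ->
        (exists S : {set 'M['I_m]_n}, is_MOFS lam S /\ #|S| = E) ->
        m * E <= maxFPA lam (n * lam) (n * lam - lam ^ 2),
      forall q i : nat, prime_power q -> 1 <= i ->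
        (q * (q ^ i - 1) ^ 2) %/ (q - 1)
          <= maxFPA (q ^ (i - 1)) (q ^ (2 * i - 1))
               (q ^ (2 * i - 1) - q ^ (2 * i - 2))
    & forall q : nat, prime_power q -> maxFPA 1 q (q - 1) = q * (q - 1)].
Proof.
have gt1 q : prime_power q -> 1 < q.
  case=> p [k [p_pr k0 ->]].
  by rewrite -(exp1n k) ltn_exp2r ?prime_gt1.
have lower (q i : nat) : prime_power q -> 1 <= i ->
    (q * (q ^ i - 1) ^ 2) %/ (q - 1)
      <= maxFPA (q ^ (i - 1)) (q ^ (2 * i - 1)) (q ^ (2 * i - 1) - q ^ (2 * i - 2)).
  move=> qpp i0; have q1 := gt1 q qpp; have q0 := ltnW q1.
  have [S [hS cardS]] := linear_MOFS q i qpp i0.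
  rewrite -cardS mulnA mulnK ?subn_gt0 //.
  (* Writing the exponent as a successor resolves the truncated subtractions, so that q^(2i-1) = q^i
     q^(i-1). *)
  case: i i0 S hS {cardS} => // i _ S.
  rewrite subn1 mulnS addKn add2n subn1 /= => hS.
  have := MOFS_maxFPA _ _ _ S q0 _ (expnS q i) hS; rewrite expn_gt0 q0 => /(_ isT).
  by rewrite -expnD -expnM addSn addnn muln2 -mul2n.
split=> //; first by move=> n m lam E m0 l0 nE _ [S [hS <-]]; apply: MOFS_maxFPA.
move=> q qpp; have q1 := gt1 q qpp; apply/eqP; rewrite eqn_leq maxFPA1_le //=.
have := lower q 1 qpp isT.
by rewrite muln1 subnn !expn1 expnS expn1 mulnA mulnK ?subn_gt0.
Qed.
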